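(* Let $\Phi,\Psi\in\{\Gamma_k,\mathcal{K}\}$ and $\star\in\{1,fin\}$. Then for a space $X$ the following statements are equivalent: (1) each open set $Y\subseteq X$ has the property $S_\star(\Phi,\Psi)$; (2) for each $E\in 2^X$, the hyperspace $(2^X,\mathbf{F}^+)$ satisfies $S_\star(\Phi_E,\Psi_E)$.
   Context: Standing assumption: all spaces $X$ are Hausdorff and non-compact unless otherwise stated. For a space $X$, $2^X$ is the family of all closed subsets of $X$ (including $\emptyset$). For $A\subseteq X$ put $A^c=X\setminus A$ and $A^+=\{F\in 2^X: F\subseteq A\}$. The upper Fell topology $\mathbf{F}^+$ on $2^X$ has base $\{(D^c)^+: D\subseteq X \text{ non-empty compact}\}\cup\{2^X\}$. Covers are non-trivial: $\mathcal{U}$ is a cover of $Y$ if $Y=\bigcup\mathcal{U}$ and $Y\notin\mathcal{U}$. An open cover $\mathcal{U}$ of a space $Y$ is a $k$-cover if each compact subset of $Y$ is contained in an element of $\mathcal{U}$; it is a $\gamma_k$-cover if it is infinite and for each compact $C\subseteq Y$ the set $\{U\in\mathcal{U}: C\not\subseteq U\}$ is finite. For the property $S_\star(\Phi,\Psi)$ of $Y$, $\mathcal{K}$ and $\Gamma_k$ are the families of all open $k$-covers, respectively open $\gamma_k$-covers, of $Y$ (with the subspace topology). Selection principles: $S_1(\mathcal{A},\mathcal{B})$ says that for each sequence $(A_n)_{n\in\mathbb{N}}$ of elements of $\mathcal{A}$ there are $b_n\in A_n$ ($n\in\mathbb{N}$) such that $\{b_n:n\in\mathbb{N}\}\in\mathcal{B}$.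 $S_{fin}(\mathcal{A},\mathcal{B})$ says that for each sequence $(A_n)_{n\in\mathbb{N}}$ of elements of $\mathcal{A}$ there are finite sets $B_n\subseteq A_n$ such that $\bigcup_{n\in\mathbb{N}}B_n\in\mathcal{B}$. For a point $E$ of the topological space $(2^X,\mathbf{F}^+)$: $\Omega_E=\{\mathcal{A}\subseteq 2^X: E\in\overline{\mathcal{A}}\setminus\mathcal{A}\}$, and $\Gamma_E$ is the set of non-trivial convergent sequences to $E$, i.e. of all sets $\mathcal{A}=\{A_n:n\in\mathbb{N}\}\subseteq 2^X$ with $E\notin\mathcal{A}$ for which the sequence $(A_n)$ (repetitions allowed) converges to $E$. $\Phi_E$ denotes $\Omega_E$ if $\Phi=\mathcal{K}$ and $\Gamma_E$ if $\Phi=\Gamma_k$; similarly $\Psi_E$. *)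

(* Defs.v *)
From HB Require Import structures.
From mathcomp Require Import all_boot all_order all_algebra.
From mathcomp Require Import all_classical all_reals topology.

Set Implicit Arguments.
Unset Strict Implicit.
Unset Printing Implicit Defensive.

Local Open Scope classical_set_scope.

Inductive selection_kind : Type := select_one | select_fin.

Definition S1 (T : Type) (A B : set (set T)) : Prop :=
  forall a : nat -> set T, (forall n, A (a n)) ->
    exists2 b : nat -> T, (forall n, a n (b n)) & B (range b).

Definition Sfin (T : Type) (A B : set (set T)) : Prop :=
  forall a : nat -> set T, (forall n, A (a n)) ->
    exists2 b : nat -> set T,
      (forall n, b n `<=` a n /\ finite_set (b n)) & B (\bigcup_n b n).

Definition selection_principle (star : selection_kind) (T : Type)
    (A B : set (set T)) : Prop :=
  match star with
  | select_one => S1 A B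
  | select_fin => Sfin A B
  end.

(* Covers are required to be non-trivial: the whole space is not a member. *)
Definition open_cover (Y : topologicalType) (U : set (set Y)) : Prop :=
  [/\ U `<=` open, \bigcup_(V in U) V = [set: Y] & ~ U [set: Y]].

Definition k_cover (Y : topologicalType) (U : set (set Y)) : Prop :=
  open_cover U /\
  forall C : set Y, compact C -> exists2 V, U V & C `<=` V.

Definition gamma_k_cover (Y : topologicalType) (U : set (set Y)) : Prop :=
  [/\ open_cover U, infinite_set U &
      forall C : set Y, compact C -> finite_set [set V | U V /\ ~ C `<=` V]].

Inductive cover_kind : Type := k_kind | gamma_k_kind.

Definition cover_family (Phi : cover_kind) (Y : topologicalType) :
    set (set (set Y)) :=
  match Phi with
  | k_kind => [set U | k_cover U]
  | gamma_k_kind => [set U | gamma_k_cover U]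
  end.
Arguments cover_family Phi Y : clear implicits.

Record hyperspace (X : topologicalType) : Type := Hyperspace {
  hset :> set X;
  hset_closed : closed hset
}.

HB.instance Definition _ (X : topologicalType) :=
  gen_eqMixin (hyperspace X).
HB.instance Definition _ (X : topologicalType) :=
  gen_choiceMixin (hyperspace X).

Definition hplus (X : topologicalType) (A : set X) : set (hyperspace X) :=
  [set F : hyperspace X | F `<=` A].

Definition upper_fell_base (X : topologicalType) : set (set (hyperspace X)) :=
  [set hplus (~` D) | D in [set D : set X | D !=set0 /\ compact D]]
  `|` [set [set: hyperspace X]].

Lemma upper_fell_base_cover (X : topologicalType) :
  \bigcup_(B in @upper_fell_base X) B = [set: hyperspace X].
Proof. by apply/seteqP; split=> // F _; exists setT => //; right. Qed.

Lemma upper_fell_base_join (X : topologicalType)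
    (A B : set (hyperspace X)) (F : hyperspace X) :
  upper_fell_base A -> upper_fell_base B -> A F -> B F ->
  exists C, [/\ upper_fell_base C, C F & C `<=` A `&` B].
Proof.
move=> [[D [D0 cD] <-]|->]; last by move=> bB _ BF; exists B; split.
move=> [[D' [D'0 cD'] <-]|->] AF BF; last first.
  by exists (hplus (~` D)); split=> //; left; exists D.
exists (hplus (~` (D `|` D'))); split.
- left; exists (D `|` D') => //; split; last exact: compactU.
  by case: D0 => x Dx; exists x; left.
- by move=> x Fx [Dx|Dx]; [exact: (AF x Fx)|exact: (BF x Fx)].
- by move=> G GDD; split=> x Gx Dx; apply: (GDD x Gx); [left|right].
Qed.

HB.instance Definition _ (X : topologicalType) :=
  isBaseTopological.Build (hyperspace X)
    (@upper_fell_base_cover X) (@upper_fell_base_join X).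

Definition Omega_at (H : topologicalType) (E : H) : set (set H) :=
  [set A | (closure A `\` A) E].

(* The points of a non-trivial convergent sequence may be repeated, so the
   range may be finite. *)
Definition Gamma_at (H : topologicalType) (E : H) : set (set H) :=
  [set A | ~ A E /\
    exists a : nat -> H, A = range a /\ a n @[n --> \oo] --> E].

Definition point_family (Phi : cover_kind) (H : topologicalType) (E : H) :
    set (set H) :=
  match Phi with
  | k_kind => Omega_at E
  | gamma_k_kind => Gamma_at E
  end.

(* Main.v *)
(* For a closed set E with complement Y, a closed set F is sent to its trace
   Y \ F. The neighbourhoods of E are generated by the sets of those F whose
   trace contains a given compact subset of Y, so families clustering at
   (sequences converging to) E correspond to k-covers (gamma-k covers) of Y,
   except that a proper subset F of E has the trivial trace Y; such an F lies
   in every neighbourhood of E, so selecting it is always harmless. *)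

Require Import Defs.
From HB Require Import structures.
From mathcomp Require Import all_boot all_order all_algebra.
From mathcomp Require Import all_classical all_reals topology.

Set Implicit Arguments.
Unset Strict Implicit.

Local Open Scope classical_set_scope.

(** * Infinite sets and injective sequences *)

Lemma finite_set_near_notin (A : set nat) :
  finite_set A -> \forall n \near \oo, ~ A n.
Proof.
move=> /finite_seqP[s ->]; exists (\max_(i <- s) i).+1 => // n /= lt_sn sn.
by have := leq_bigmax_seq (F := id) n sn isT; rewrite leqNgt lt_sn.
Qed.

Lemma injective_near_ge (h : nat -> nat) (n : nat) :
  injective h -> \forall j \near \oo, (n <= h j)%N.
Proof.
move=> injh.
have /finite_set_near_notin : finite_set (h @^-1` `I_n).
  by apply: finite_preimage (finite_II n) => i j _ _; exact: injh.
by apply: filterS => j /= /negP; rewrite -leqNgt.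
Qed.

Lemma infinite_set_inj_seq (T : pointedType) (A : set T) :
  infinite_set A -> exists2 v : nat -> T, injective v & forall n, A (v n).
Proof.
move=> /infiniteP/pcard_leP[f]; exists f => [i j|n].
  by apply: 'inj_f; rewrite inE.
exact: 'funS_f.
Qed.

Lemma countable_infinite_enum (T : pointedType) (A : set T) :
  countable A -> infinite_set A ->
  exists2 v : nat -> T, injective v & range v = A.
Proof.
move=> cA iA; have := eq_card_nat cA iA.
rewrite card_eq_sym => /card_set_bijP[f [funf injf surf]]; exists f.
  by move=> i j; apply: injf; rewrite inE.
by apply/seteqP; split=> [_ [n _ <-]|x /surf//]; exact: funf.
Qed.

(** * Gamma-k covers as ranges of sequences *)

Definition k_converges (Y : topologicalType) (v : nat -> set Y) : Prop :=
  forall C : set Y, compact C -> \forall n \near \oo, C `<=` v n.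

Lemma k_cover_open_cover (Y : topologicalType) (U : set (set Y)) :
  U `<=` open -> ~ U [set: Y] ->
  (forall C : set Y, compact C -> exists2 V, U V & C `<=` V) -> k_cover U.
Proof.
move=> oU UT kU; split=> //; split=> //; apply/seteqP; split=> // y _.
by have [V UV yV] := kU _ (@compact_set1 _ y); exists V => //; exact: yV.
Qed.

Lemma gamma_k_cover_range (Y : topologicalType) (v : nat -> set Y) :
  (forall n, open (v n)) -> (forall n, v n <> [set: Y]) -> k_converges v ->
  gamma_k_cover (range v).
Proof.
move=> ov vT kv; split.
- suff [] : k_cover (range v) by [].
  apply: k_cover_open_cover => [_ [n _ <-]//|[n _ /vT]//|C /kv[N _ /(_ N)Cv]].
  by exists (v N); [exists N|exact: Cv (leqnn N)].
- move=> fv.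
  (* A finite family of proper subsets misses the finite, hence compact, set
     formed by one point outside each member. *)
  have /choice[p vp] : forall V : set Y, exists y, V <> [set: Y] -> ~ V y.
    have /eqP/setTPn[y0 _] := vT 0%N.
    by move=> V; have [->|/setTPn[y]] := eqVneq V [set: Y]; [exists y0|exists y].
  have /finite_compact/kv[N _ /(_ N (leqnn N))] := finite_image p fv.
  by move=> pvN; apply: (vp _ (vT N)); apply: pvN; exists (v N) => //; exists N.
- move=> C /kv[N _ CN].
  apply: (@sub_finite_set _ _ (v @` `I_N)); last exact/finite_image/finite_II.
  move=> _ [[n _ <-] Cvn]; exists n => //=; rewrite ltnNge; apply/negP => Nn.
  by apply: Cvn; exact: CN.
Qed.

(** Only finitely many members of [U] fail to contain [C], and injectivity lets each of them occur
    at most once. *)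
Lemma gamma_k_cover_inj_seq (Y : topologicalType) (U : set (set Y))
    (v : nat -> set Y) :
  gamma_k_cover U -> injective v -> (forall n, U (v n)) -> k_converges v.
Proof.
move=> [_ _ fU] injv Uv C /fU fC.
have : finite_set (v @^-1` [set V | U V /\ ~ C `<=` V]).
  by apply: finite_preimage fC => i j _ _; exact: injv.
move=> /finite_set_near_notin; apply: filterS => n CV.
by apply: contrapT => nC; apply: CV; split.
Qed.

Lemma cover_family_neq0 (Phi : cover_kind) (Y : topologicalType)
    (U : set (set Y)) : cover_family Phi Y U -> U !=set0.
Proof.
case: Phi => [[_ /(_ _ (@compact0 Y))[V UV _]]|[_ /infinite_setN0//]].
by exists V.
Qed.

Lemma cover_family_open (Phi : cover_kind) (Y : topologicalType)
    (U : set (set Y)) (V : set Y) : cover_family Phi Y U -> U V -> open V.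
Proof. by case: Phi => [[[oU _ _] _]|[[oU _ _] _ _]] UV; exact: oU. Qed.

Lemma cover_family_neqT (Phi : cover_kind) (Y : topologicalType)
    (U : set (set Y)) (V : set Y) :
  cover_family Phi Y U -> U V -> V <> [set: Y].
Proof.
by case: Phi => [[[_ _ UT] _]|[[_ _ UT] _ _]] UV VT; apply: UT; rewrite -VT.
Qed.

(** * Refinements, and selecting a convergent sequence *)

Definition refines (Y : Type) (W U : set (set Y)) : Prop :=
  forall V, W V -> exists2 V', U V' & V `<=` V'.

Lemma refines_trans (Y : Type) (U V W : set (set Y)) :
  refines W V -> refines V U -> refines W U.
Proof.
move=> WV VU A /WV[B /VU[C UC BC] AB]; exists C => //; exact: subset_trans BC.
Qed.

(** All pairwise intersections serve for k-covers. For gamma-k covers one bad member could spoil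
    infinitely many of them, so two injective sequences are intersected term by term. *)
Lemma cover_family_common_refinement (Phi : cover_kind) (Y : topologicalType)
    (U W : set (set Y)) :
  cover_family Phi Y U -> cover_family Phi Y W ->
  exists Z, [/\ cover_family Phi Y Z, refines Z U & refines Z W].
Proof.
move=> cU cW; have oU V := @cover_family_open _ _ _ V cU.
have oW V := @cover_family_open _ _ _ V cW.
have UT V := @cover_family_neqT _ _ _ V cU.
have IT (A B : set Y) : A <> [set: Y] -> A `&` B <> [set: Y].
  move=> AT ABT; apply: AT; apply/seteqP; split=> // y _.
  by have [] : (A `&` B) y by rewrite ABT.
case: Phi cU cW => cU cW.
- exists [set A `&` B | A in U & B in W]; split.
  + apply: k_cover_open_cover.
    * by move=> _ [A UA [B WB <-]]; apply: openI; [exact: oU|exact: oW].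
    * by move=> [A UA [B WB]]; exact/IT/UT.
    * move=> C cC; have [A UA CA] := cU.2 C cC; have [B WB CB] := cW.2 C cC.
      by exists (A `&` B); [exists A => //; exists B|rewrite subsetI].
  + by move=> _ [A UA [B WB <-]]; exists A.
  + by move=> _ [A UA [B WB <-]]; exists B.
- have [u inju Uu] := infinite_set_inj_seq (let: And3 _ iU _ := cU in iU).
  have [w injw Ww] := infinite_set_inj_seq (let: And3 _ iW _ := cW in iW).
  have ku := gamma_k_cover_inj_seq cU inju Uu.
  have kw := gamma_k_cover_inj_seq cW injw Ww.
  exists (range (fun n => u n `&` w n)); split.
  + apply: gamma_k_cover_range => [n|n|C cC].
    * by apply: openI; [exact: oU|exact: oW].
    * exact/IT/UT.
    * near=> n; rewrite subsetI; split; near: n; [exact: ku|exact: kw].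
  + by move=> _ [n _ <-]; exists (u n).
  + by move=> _ [n _ <-]; exists (w n).
Unshelve. all: by end_near.
Qed.

Lemma cover_family_decreasing_refinement (Phi : cover_kind)
    (Y : topologicalType) (U : nat -> set (set Y)) :
  (forall n, cover_family Phi Y (U n)) ->
  exists W : nat -> set (set Y), (forall n, cover_family Phi Y (W n)) /\
    forall m n, (m <= n)%N -> refines (W n) (U m).
Proof.
move=> cU.
have /choice[f fP] : forall p : set (set Y) * set (set Y), exists Z,
    cover_family Phi Y p.1 -> cover_family Phi Y p.2 ->
    [/\ cover_family Phi Y Z, refines Z p.1 & refines Z p.2].
  move=> [A B]; have [cA|ncA] := pselect (cover_family Phi Y A); last by exists A.
  have [cB|ncB] := pselect (cover_family Phi Y B); last by exists A.
  by have [Z] := cover_family_common_refinement cA cB; exists Z.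
pose W := fix W n := if n is m.+1 then f (W m, U m.+1) else U 0%N.
have cW n : cover_family Phi Y (W n).
  by elim: n => [|n IH]; [exact: cU|case: (fP (W n, U n.+1) IH (cU n.+1))].
exists W; split=> // m; elim=> [|n IH].
  by rewrite leqn0 => /eqP-> V UV; exists V.
have [_ WW WU] := fP (W n, U n.+1) (cW n) (cU n.+1).
rewrite leq_eqVlt => /predU1P[->//|/IH]; exact: refines_trans.
Qed.

(* The set selected by [S1] may come from a sequence with infinitely many
   repetitions, which need not converge. Selecting from decreasing refinements
   and then spreading an injective subsequence upwards cures this. *)
Lemma S1_gamma_k_converges (Phi : cover_kind) (Y : topologicalType)
    (U : nat -> set (set Y)) :
  S1 (cover_family Phi Y) (cover_family gamma_k_kind Y) ->
  (forall n, cover_family Phi Y (U n)) ->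
  exists2 v : nat -> set Y, (forall n, U n (v n)) & k_converges v.
Proof.
move=> sel /cover_family_decreasing_refinement[W [cW WU]].
have [z Wz gz] := sel W cW.
have [w injw zw] := infinite_set_inj_seq (let: And3 _ iz _ := gz in iz).
have kw := gamma_k_cover_inj_seq gz injw zw.
have /choice[h hP] : forall j, exists i, z i = w j.
  by move=> j; have [i _ zi] := zw j; exists i.
have injh : injective h by move=> i j hij; apply: injw; rewrite -!hP hij.
have /choice[v vP] : forall n, exists V,
    U n V /\ exists2 j, (n <= j)%N & w j `<=` V.
  move=> n; have [N _ hN] := @injective_near_ge h n injh.
  (* The index [maxn n N] does two jobs: its image under [h] is at least [n], so the selected set
     refines [U n]; it is itself at least [n], so convergence of [w] passes to [v]. *)
  have [V UV wV] :=
    WU n _ (hN (maxn n N) (leq_maxr _ _)) _ (Wz (h (maxn n N))).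
  by exists V; split=> //; exists (maxn n N); [exact: leq_maxl|rewrite -hP].
exists v => [n|C /kw[N _ CN]]; first by have [] := vP n.
exists N => // n /= Nn; have [_ [j nj]] := vP n.
by apply: subset_trans; apply: CN; exact: leq_trans nj.
Qed.

(** * Traces on the complement of [E] and the topology near [E] *)

Lemma compact_set_val (X : topologicalType) (Y : set X)
    (C : set (set_type Y)) : compact C -> compact (set_val @` C).
Proof.
move=> cC; apply: continuous_compact => //; apply: continuous_subspaceT.
exact: initial_continuous.
Qed.

Lemma compact_set_val_preimage (X : topologicalType) (Y D : set X) :
  D `<=` Y -> compact D -> compact (set_val @^-1` D : set (set_type Y)).
Proof.
move=> DY cD F FF FD; have [x [Dx clx]] := cD (set_val @ F) _ FD.
exists (SigSub (mem_set (DY _ Dx))); split=> // A B FA.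
rewrite nbhsE => -[_ [[O oO <-] Ox] OB].
have [||_ [[a Aa <-] Oa]] := clx (set_val @` A) O.
- by apply: (@filterS _ F _ A) FA => a Aa; exists a.
- by apply: open_nbhs_nbhs; split.
- by exists a; split=> //; exact: OB.
Qed.

Lemma nbhs_hyperspace (X : topologicalType) (E : hyperspace X)
    (O : set (hyperspace X)) :
  nbhs E O <-> exists D : set X,
    [/\ compact D, D `<=` ~` E & hplus (~` D) `<=` O].
Proof.
rewrite nbhsE; split=> [[_ [[B baseB <-] [b Bb bE] BO]]|[D [cD DE DO]]].
  have [[D [_ cD] Db]|bT] := baseB b Bb.
    exists D; split=> // [x Dx Ex|F DF].
      by move: bE; rewrite -Db => /(_ x Ex).
    by apply: BO; exists b => //; rewrite -Db.
  (* The base admits only non-empty [D]; the empty one stands for the base member that is the whole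
     hyperspace. *)
  exists set0; split=> [||F _]; [exact: compact0|exact: sub0set|].
  by apply: BO; exists b => //; rewrite bT.
have [D0|/set0P D0] := eqVneq D set0.
  exists [set: hyperspace X]; first by split=> //; exact: openT.
  by move=> F _; apply: DO; rewrite D0 setC0.
exists (hplus (~` D)) => //; split; last by move=> x Ex Dx; exact: DE Ex.
exists [set hplus (~` D)]; last exact: bigcup_set1.
by move=> _ ->; left; exists D.
Qed.

Definition trace (X : topologicalType) (E F : hyperspace X) :
  set (set_type (~` E)) := [set y | ~ hset F (set_val y)].
Arguments trace {X} E F _.

(* The closure is vacuous when V is open; it makes the map total. *)
Definition untrace (X : topologicalType) (E : hyperspace X)
    (V : set (set_type (~` E))) : hyperspace X :=
  Hyperspace (@closed_closure X (~` (set_val @` V))).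

Lemma open_trace (X : topologicalType) (E F : hyperspace X) :
  open (trace E F).
Proof. by exists (~` F) => //; exact/closed_openC/hset_closed. Qed.

Lemma untraceK (X : topologicalType) (E : hyperspace X)
    (V : set (set_type (~` E))) : open V -> trace E (untrace V) = V.
Proof.
move=> [O oO OV]; rewrite /trace /= (_ : closure _ = ~` (set_val @` V)).
  apply/seteqP; split=> [y /contrapT[z Vz]|y Vy].
    by move=> /val_inj <-.
  by move=> /(_ _); apply; exists y.
apply/esym/closure_id; apply: open_closedC.
(* The complement of [E] is open, so [V] is open in [X] as well. *)
rewrite (_ : _ @` _ = O `&` ~` E).
  by apply: openI => //; exact/closed_openC/hset_closed.
apply/seteqP; split=> [_ [y Vy <-]|x [Ox Ex]].
  by split; [move: Vy; rewrite -OV|exact: set_valP].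
by exists (SigSub (mem_set Ex)) => //; rewrite -OV.
Qed.

Lemma trace_eqT (X : topologicalType) (E F : hyperspace X) :
  trace E F = [set: set_type (~` E)] <-> F `<=` E.
Proof.
split=> [FT x Fx|FE].
  apply: contrapT => Ex.
  have : trace E F (SigSub (mem_set (Ex : (~` E) x))) by rewrite FT.
  exact.
by apply/seteqP; split=> // y _ /FE; exact: set_valP y.
Qed.

(** The compact sets of the subspace are exactly the compact sets of [X] that miss [E]. *)
Lemma nbhs_trace (X : topologicalType) (E : hyperspace X)
    (O : set (hyperspace X)) :
  nbhs E O <-> exists2 C : set (set_type (~` E)), compact C &
    [set F | C `<=` trace E F] `<=` O.
Proof.
rewrite nbhs_hyperspace; split=> [[D [cD DE DO]]|[C cC CO]].
  exists (set_val @^-1` D); first exact: compact_set_val_preimage.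
  move=> F CF; apply: DO => x Fx Dx.
  exact: (CF (SigSub (mem_set (DE _ Dx))) Dx Fx).
exists (set_val @` C); split; first exact: compact_set_val.
  by move=> _ [y _ <-]; exact: set_valP.
by move=> F DF; apply: CO => y Cy /DF; apply; exists y.
Qed.

Lemma closure_trace (X : topologicalType) (E : hyperspace X)
    (A : set (hyperspace X)) :
  closure A E <-> forall C : set (set_type (~` E)), compact C ->
    exists2 F, A F & C `<=` trace E F.
Proof.
split=> [clA C cC|kA O /(nbhs_trace E O)[C cC CO]].
  have [|F [AF CF]] := clA [set F | C `<=` trace E F]; last by exists F.
  by apply/nbhs_trace; exists C.
by have [F AF CF] := kA C cC; exists F; split=> //; exact: CO.
Qed.

Lemma cvg_trace (X : topologicalType) (E : hyperspace X)
    (a : nat -> hyperspace X) :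
  a n @[n --> \oo] --> E <-> k_converges (fun n => trace E (a n)).
Proof.
split=> [aE C cC|ka O /nbhs_trace[C /ka Ca CO]].
  by apply: (aE [set F | C `<=` trace E F]); apply/nbhs_trace; exists C.
by apply: filterS Ca => n; exact: CO.
Qed.

(** * From families at a point to covers and back *)

Lemma point_family_notin (Phi : cover_kind) (H : topologicalType) (E : H)
    (A : set H) : point_family Phi E A -> ~ A E.
Proof. by case: Phi => -[]. Qed.

Lemma point_family_neq0 (Phi : cover_kind) (H : topologicalType) (E : H)
    (A : set H) : point_family Phi E A -> A !=set0.
Proof.
case: Phi => [[clA _]|[_ [a [-> _]]]]; last by exists (a 0%N), 0%N.
by have [F [AF _]] := clA setT filterT; exists F.
Qed.

Lemma Gamma_at_range (X : topologicalType) (E : hyperspace X)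
    (a : nat -> hyperspace X) :
  (forall n, a n <> E) -> k_converges (fun n => trace E (a n)) ->
  Gamma_at E (range a).
Proof.
by move=> aE /cvg_trace cvga; split=> [[n _ /aE]//|]; exists a.
Qed.

(** The trace of [F] contains every compact set; in the gamma case the constant sequence
    converges. *)
Lemma point_family_set1 (Phi : cover_kind) (X : topologicalType)
    (E F : hyperspace X) : F <> E -> F `<=` E -> point_family Phi E [set F].
Proof.
move=> nFE /trace_eqT FT; case: Phi.
  split; last by move=> EF; exact: nFE.
  by apply/closure_trace => C _; exists F => //; rewrite FT.
rewrite (_ : [set F] = range (fun _ : nat => F)).
  by apply: Gamma_at_range => // C _; apply: nearW => n; rewrite FT.
by apply/seteqP; split=> [_ ->|_ [n _ <-]//]; exists 0%N.
Qed.

(** Distinct members of [A] may share a trace, but k-convergence of proper open subsets already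
    forces their range to be infinite. *)
Lemma trace_cover_family (Phi : cover_kind) (X : topologicalType)
    (E : hyperspace X) (A : set (hyperspace X)) :
  point_family Phi E A -> (forall F, A F -> ~ F `<=` E) ->
  cover_family Phi (set_type (~` E)) (trace E @` A).
Proof.
move=> + AE; case: Phi => [[/closure_trace clA _]|].
  apply: k_cover_open_cover.
  - by move=> _ [F _ <-]; exact: open_trace.
  - by move=> [F AF /trace_eqT]; exact: AE.
  - by move=> C /clA[F AF CF]; exists (trace E F) => //; exists F.
move=> [_ [a [Aa /cvg_trace ka]]]; rewrite Aa image_comp.
apply: gamma_k_cover_range => // n; first exact: open_trace.
by move=> /trace_eqT; apply: AE; rewrite Aa; exists n.
Qed.

(* Countability is needed since [Gamma_at] consists of ranges of sequences,
   whereas a gamma-k cover may be uncountable. *)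
Lemma point_family_lift (Phi : cover_kind) (X : topologicalType)
    (E : hyperspace X) (W : set (set (set_type (~` E))))
    (g : set (set_type (~` E)) -> hyperspace X) :
  (Phi = gamma_k_kind -> countable W) ->
  cover_family Phi (set_type (~` E)) W ->
  (forall V, W V -> trace E (g V) = V) -> point_family Phi E (g @` W).
Proof.
move=> ctW cW gK.
have gE V : W V -> g V <> E.
  move=> WV gVE; apply: (cover_family_neqT cW WV).
  by rewrite -(gK V WV); apply/trace_eqT; rewrite gVE.
case: Phi cW ctW => cW ctW.
  split; last by move=> [V /gE].
  apply/closure_trace => C /(cW.2)[V WV CV].
  by exists (g V); [exists V|rewrite gK].
have [w injw wW] := countable_infinite_enum (ctW erefl) (let: And3 _ iW _ := cW in iW).
have Ww n : W (w n) by rewrite -wW; exists n.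
rewrite -wW image_comp; apply: Gamma_at_range => [n|]; first exact: gE.
rewrite (_ : (fun n => _) = w); first exact: gamma_k_cover_inj_seq injw Ww.
by apply/funext => n; exact: gK.
Qed.

(** Any injective sequence drawn from a gamma-k cover again ranges over one. *)
Lemma cover_family_countable_subset (Phi : cover_kind) (Y : topologicalType)
    (U : set (set Y)) : cover_family Phi Y U ->
  exists W, [/\ W `<=` U, cover_family Phi Y W &
    Phi = gamma_k_kind -> countable W].
Proof.
move=> cU; case: Phi cU => cU; first by exists U; split.
have [v injv Uv] := infinite_set_inj_seq (let: And3 _ iU _ := cU in iU).
exists (range v); split=> [_ [n _ <-]//||_].
  apply: gamma_k_cover_range => [n|n|].
  - exact: (@cover_family_open gamma_k_kind _ _ _ cU).
  - exact: (@cover_family_neqT gamma_k_kind _ _ _ cU).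
  - exact: gamma_k_cover_inj_seq injv Uv.
exact: sub_countable (card_image_le _ _) _.
Qed.

Lemma cover_family_point_family (Phi : cover_kind) (X : topologicalType)
    (E : hyperspace X) (U : set (set (set_type (~` E)))) :
  cover_family Phi (set_type (~` E)) U ->
  exists2 A, point_family Phi E A & forall F, A F -> U (trace E F).
Proof.
move=> /cover_family_countable_subset[W [WU cW ctW]].
have WK V : W V -> trace E (untrace V) = V.
  by move=> WV; exact/untraceK/(cover_family_open cW).
exists (@untrace X E @` W); first exact: point_family_lift.
by move=> _ [V WV <-]; rewrite WK //; exact: WU.
Qed.

(** * Transfer of the selection principles *)

Lemma selection_principle_complement (Phi Psi : cover_kind)
    (star : selection_kind) (X : topologicalType) (E : hyperspace X) :
  selection_principle star (point_family Phi E) (point_family Psi E) ->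
  selection_principle star (cover_family Phi (set_type (~` E)))
    (cover_family Psi (set_type (~` E))).
Proof.
move=> sel.
have lift (U : nat -> _) : (forall n, cover_family Phi (set_type (~` E)) (U n)) ->
    {A | forall n, point_family Phi E (A n) /\
      forall F, A n F -> U n (trace E F)}.
  move=> cU; have /choice[A AP] : forall n, exists A,
      point_family Phi E A /\ forall F, A F -> U n (trace E F).
    by move=> n; have [A] := cover_family_point_family (cU n); exists A.
  by exists A.
(* Covers are non-trivial, so nothing selected has the trivial trace. *)
have neE (U : set _) F : cover_family Phi (set_type (~` E)) U ->
    U (trace E F) -> ~ F `<=` E.
  by move=> cU UF /trace_eqT; exact: cover_family_neqT cU UF.
case: star sel => sel U cU; have [A AP] := lift U cU.
  have [b Ab cb] := sel A (fun n => (AP n).1).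
  have Ub n : U n (trace E (b n)) by exact: (AP n).2.
  exists (fun n => trace E (b n)) => //.
  rewrite -(image_comp b (trace E)); apply: trace_cover_family cb _.
  by move=> _ [n _ <-]; exact: neE (cU n) (Ub n).
have [B BA cB] := sel A (fun n => (AP n).1).
have UB n F : B n F -> U n (trace E F).
  by move=> /((BA n).1) AF; exact: (AP n).2.
exists (fun n => trace E @` B n).
  move=> n; split; first by move=> _ [F /UB + <-].
  exact/finite_image/(BA n).2.
rewrite -image_bigcup; apply: trace_cover_family cB _.
by move=> F [n _ BF]; exact: neE (cU n) (UB n F BF).
Qed.

Lemma S1_point_family (Phi Psi : cover_kind) (X : topologicalType)
    (E : hyperspace X) :
  S1 (cover_family Phi (set_type (~` E)))
    (cover_family Psi (set_type (~` E))) ->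
  S1 (point_family Phi E) (point_family Psi E).
Proof.
move=> sel A cA.
have [F0 F0P] : exists F0 : nat -> hyperspace X, forall n, A n (F0 n) /\
    ((exists2 F, A n F & F `<=` E) -> F0 n `<=` E).
  have /choice[F0 F0P] : forall n, exists F, A n F /\
      ((exists2 F, A n F & F `<=` E) -> F `<=` E).
    move=> n; have [[F AF FE]|nF] := pselect (exists2 F, A n F & F `<=` E).
      by exists F.
    by have [F AF] := point_family_neq0 (cA n); exists F.
  by exists F0.
have neE (b : nat -> hyperspace X) : (forall n, A n (b n)) ->
    forall n, b n <> E.
  by move=> Ab n bE; apply: (point_family_notin (cA n)); rewrite -bE.
pose triv n := exists2 F, A n F & F `<=` E.
(* If every [A n] has a member inside [E], the choices [F0 n] all have trivial trace and suffice by
   themselves; otherwise some [A i0] has a cover as its traces. *)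
have [allt|/existsNP[i0 ni0]] := pselect (forall n, triv n).
  have F0T n : trace E (F0 n) = [set: _] by apply/trace_eqT/(F0P n).2/allt.
  have F0A n : A n (F0 n) by exact: (F0P n).1.
  exists F0 => //; case: Psi {sel}.
    split; last by move=> [n _]; exact: neE.
    by apply/closure_trace => C _; exists (F0 0%N); [exists 0%N|rewrite F0T].
  by apply: Gamma_at_range => [|C _]; [exact: neE|apply: nearW => n; rewrite F0T].
(* The A n containing a subset of E are replaced by A i0 during the selection;
   their own choice F0 n is restored afterwards. *)
pose A' n := if pselect (triv n) then A i0 else A n.
have ntA' n F : A' n F -> ~ F `<=` E.
  rewrite /A'; case: pselect => [t|nt] /= AF FE; last by apply: nt; exists F.
  by apply: ni0; exists F.
have cA' n : cover_family Phi (set_type (~` E)) (trace E @` A' n).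
  apply: trace_cover_family => [|F]; last exact: ntA'.
  by rewrite /A'; case: pselect => t /=; exact: cA.
(* Returning to the original [A n] can only enlarge the traces, since a restored [F0 n] has trivial
   trace. *)
have patch (v : nat -> set (set_type (~` E))) :
    (forall n, (trace E @` A' n) (v n)) ->
    exists2 b, (forall n, A n (b n)) & forall n, v n `<=` trace E (b n).
  move=> A'v; have /choice[b bP] : forall n, exists F, A n F /\ v n `<=` trace E F.
    move=> n; have [F] := A'v n; rewrite /A'; case: pselect => [t|_] /= AF Fv.
      exists (F0 n); split; first exact: (F0P n).1.
      by rewrite (_ : trace _ _ = setT) //; apply/trace_eqT/(F0P n).2.
    by exists F; split=> //; rewrite Fv.
  by exists b => n; have [] := bP n.
case: Psi sel => sel.
  have [v A'v [_ kv]] := sel _ cA'; have [b Ab vb] := patch v A'v.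
  exists b => //; split; last by move=> [n _]; exact: neE.
  apply/closure_trace => C /kv[_ [n _ <-] Cv].
  by exists (b n); [exists n|exact: subset_trans (vb n)].
(* Convergence index by index survives the enlargement, whereas knowing only that [range v] is a
   gamma-k cover would not control repetitions. *)
have [v A'v kv] := S1_gamma_k_converges sel cA'; have [b Ab vb] := patch v A'v.
exists b => //; apply: Gamma_at_range; first exact: neE.
by move=> C /kv; apply: filterS => n Cv; exact: subset_trans (vb n).
Qed.

Lemma Sfin_point_family (Phi Psi : cover_kind) (X : topologicalType)
    (E : hyperspace X) :
  Sfin (cover_family Phi (set_type (~` E)))
    (cover_family Psi (set_type (~` E))) ->
  Sfin (point_family Phi E) (point_family Psi E).
Proof.
move=> sel A cA.
(* Finite selections may be empty, so a single member inside [E] is a complete answer. *)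
have [[i0 [F AF FE]]|nt] := pselect (exists n, exists2 F, A n F & F `<=` E).
  exists (fun n => if n == i0 then [set F] else set0).
    move=> n; case: eqP => [->|_]; last by split.
    by split=> // _ ->.
  rewrite (_ : \bigcup_n _ = [set F]).
    apply: point_family_set1 FE => FeE; apply: (point_family_notin (cA i0)).
    by rewrite -FeE.
  apply/seteqP; split=> [G [n _]|_ ->]; first by case: eqP.
  by exists i0 => //; rewrite eqxx.
have cU n : cover_family Phi (set_type (~` E)) (trace E @` A n).
  by apply: trace_cover_family => // F AF FE; apply: nt; exists n, F.
have [B BA cB] := sel _ cU.
pose W := \bigcup_n B n.
(* Each selected trace is lifted only once, so that the lifted family is in
   bijection with W and inherits its convergence. *)
have /choice[g gP] : forall V, exists p : nat * hyperspace X,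
    W V -> [/\ B p.1 V, A p.1 p.2 & trace E p.2 = V].
  move=> V; have [[n _ BV]|nW] := pselect (W V); last by exists (0%N, E).
  by have [F AF FV] := (BA n).1 V BV; exists (n, F).
exists (fun n => (snd \o g) @` [set V | W V /\ (g V).1 = n]).
  move=> n; split; first by move=> _ [V [/gP[_ + _] <-] <-].
  apply/finite_image/sub_finite_set/(BA n).2.
  by move=> V [/gP[+ _ _] <-].
rewrite -image_bigcup (_ : \bigcup_n _ = W); last first.
  by apply/seteqP; split=> [V [n _ []]//|V WV]; exists (g V).1.
apply: point_family_lift => // [_|V /gP[]//].
apply: bigcup_countable => // n _; exact/finite_set_countable/(BA n).2.
Qed.

Theorem theorem4p5 (Phi Psi : cover_kind) (star : selection_kind)
    (X : topologicalType) (hausdorffX : hausdorff_space X)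
    (noncompactX : ~ compact [set: X]) :
  (forall Y : set X, open Y ->
     selection_principle star
       (cover_family Phi (set_type Y)) (cover_family Psi (set_type Y))) <->
  (forall E : hyperspace X,
     selection_principle star
       (point_family Phi E) (point_family Psi E)).
Proof.
split=> [selY E|selE Y oY].
  have {selY} := selY _ (closed_openC (@hset_closed X E)).
  by case: star; [exact: S1_point_family|exact: Sfin_point_family].
rewrite -(setCK Y).
exact: (@selection_principle_complement _ _ _ _ (Hyperspace (open_closedC oY))).
Qed.
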